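(* Let $G$ be a finite abelian group of odd order. The group $G$ is isomorphic to the group of units in a commutative ring if and only if $G$ is isomorphic to the group of units in a finite direct product of finite fields of characteristic $2$. In particular, an odd positive integer $k$ is the number of units in a commutative ring if and only if $k$ is of the form $\prod_{i=1}^t (2^{n_i} - 1)$ for some positive integers $n_1, \dots, n_t$.
   Context: Rings have a multiplicative identity. The group of units of a ring is the group of its invertible elements under multiplication. *)

(* Defs.v *)
From HB Require Import structures.
From mathcomp Require Import all_boot all_fingroup all_algebra.
From mathcomp Require Import boolp classical_sets functions cardinality.

Set Implicit Arguments.
Unset Strict Implicit.
Unset Printing Implicit Defensive.

Import GRing.Theory.
Local Open Scope ring_scope.

(* [comPzRingType] is the class of all commutative rings with 1, the zero ring
   included. It carries no unit predicate, and [{unit R}] requires a finite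
   ring, hence the following definitions. As R is commutative, a one-sided
   inverse is an inverse. *)
Section UnitGroup.
Variable R : comPzRingType.

Definition invertible : {pred R} := fun x => `[< exists y : R, x * y = 1 >].

Record unitGroup := UnitGroup {
  unitGroup_val :> R;
  unitGroup_valP : unitGroup_val \in invertible }.

HB.instance Definition _ := [isSub for unitGroup_val].
HB.instance Definition _ := [Choice of unitGroup by <:].

Implicit Types x y z : unitGroup.

Lemma unitGroup_exV x : exists y : R, val x * y == 1.
Proof. by have /asboolP[y /eqP xy1] := valP x; exists y. Qed.

Definition unitGroup_invr x : R := xchoose (unitGroup_exV x).

Lemma unitGroup_mulrV x : val x * unitGroup_invr x = 1.
Proof. exact/eqP/(xchooseP (unitGroup_exV x)). Qed.

Fact unitGroup_one_subproof : (1 : R) \in invertible.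
Proof. by apply/asboolP; exists 1; rewrite mulr1. Qed.

Fact unitGroup_mul_subproof x y : val x * val y \in invertible.
Proof.
apply/asboolP; exists (unitGroup_invr x * unitGroup_invr y).
by rewrite mulrACA !unitGroup_mulrV mulr1.
Qed.

Fact unitGroup_inv_subproof x : unitGroup_invr x \in invertible.
Proof. by apply/asboolP; exists (val x); rewrite mulrC unitGroup_mulrV. Qed.

Definition unitGroup_one := UnitGroup unitGroup_one_subproof.
Definition unitGroup_mul x y := UnitGroup (unitGroup_mul_subproof x y).
Definition unitGroup_inv x := UnitGroup (unitGroup_inv_subproof x).

Fact unitGroup_mulA : associative unitGroup_mul.
Proof. by move=> x y z; apply: val_inj; rewrite /= mulrA. Qed.

Fact unitGroup_mul1 : left_id unitGroup_one unitGroup_mul.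
Proof. by move=> x; apply: val_inj; rewrite /= mul1r. Qed.

Fact unitGroup_mulr1 : right_id unitGroup_one unitGroup_mul.
Proof. by move=> x; apply: val_inj; rewrite /= mulr1. Qed.

Fact unitGroup_mulVx : left_inverse unitGroup_one unitGroup_inv unitGroup_mul.
Proof. by move=> x; apply: val_inj; rewrite /= mulrC unitGroup_mulrV. Qed.

Fact unitGroup_mulxV : right_inverse unitGroup_one unitGroup_inv unitGroup_mul.
Proof. by move=> x; apply: val_inj; rewrite /= unitGroup_mulrV. Qed.

HB.instance Definition _ := isGroup.Build unitGroup
  unitGroup_mulA unitGroup_mul1 unitGroup_mulr1 unitGroup_mulVx unitGroup_mulxV.

End UnitGroup.

Definition isomorphic (G H : groupType) : Prop :=
  exists f : {multiplicative G -> H}, bijective f.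

(* MathComp only has a ring structure on non-dependent finite functions. *)
Section DirectProduct.
Variables (I : finType) (R : I -> comPzRingType).

Definition directProduct := {dffun forall i : I, R i}.
HB.instance Definition _ := Choice.on directProduct.

Implicit Types x y z : directProduct.

Definition directProduct_zero : directProduct := [ffun i => 0 : R i].
Definition directProduct_one : directProduct := [ffun i => 1 : R i].
Definition directProduct_opp x : directProduct := [ffun i => - x i : R i].
Definition directProduct_add x y : directProduct := [ffun i => x i + y i : R i].
Definition directProduct_mul x y : directProduct := [ffun i => x i * y i : R i].

Fact directProduct_addA : associative directProduct_add.
Proof. by move=> x y z; apply/ffunP=> i; rewrite !ffunE addrA. Qed.

Fact directProduct_addC : commutative directProduct_add.
Proof. by move=> x y; apply/ffunP=> i; rewrite !ffunE addrC. Qed.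

Fact directProduct_add0 : left_id directProduct_zero directProduct_add.
Proof. by move=> x; apply/ffunP=> i; rewrite !ffunE add0r. Qed.

Fact directProduct_addN :
  left_inverse directProduct_zero directProduct_opp directProduct_add.
Proof. by move=> x; apply/ffunP=> i; rewrite !ffunE addNr. Qed.

HB.instance Definition _ := GRing.isZmodule.Build directProduct
  directProduct_addA directProduct_addC directProduct_add0 directProduct_addN.

Fact directProduct_mulA : associative directProduct_mul.
Proof. by move=> x y z; apply/ffunP=> i; rewrite !ffunE mulrA. Qed.

Fact directProduct_mulC : commutative directProduct_mul.
Proof. by move=> x y; apply/ffunP=> i; rewrite !ffunE mulrC. Qed.

Fact directProduct_mul1 : left_id directProduct_one directProduct_mul.
Proof. by move=> x; apply/ffunP=> i; rewrite !ffunE mul1r. Qed.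

Fact directProduct_mulDl :
  left_distributive directProduct_mul directProduct_add.
Proof. by move=> x y z; apply/ffunP=> i; rewrite !ffunE mulrDl. Qed.

HB.instance Definition _ := GRing.Zmodule_isComPzRing.Build directProduct
  directProduct_mulA directProduct_mulC directProduct_mul1 directProduct_mulDl.

End DirectProduct.

(* Main.v *)
(* A ring R with a unit group of odd order has -1 = 1, hence characteristic 2,
   and is reduced: if x^2 = 0 then (1 + x)^2 = 1, so 1 + x = 1. The additive span
   S of the units is then a finite reduced subring with the same units as R. Each
   x in a finite reduced ring satisfies x^d x = x for some d > 0, with x^d
   idempotent; therefore e S is a field for each minimal nonzero idempotent e, and
   S is the direct product of these fields, because the minimal nonzero
   idempotents are orthogonal with sum 1. *)
From HB Require Import structures.
Require Import Defs.
From mathcomp Require Import all_boot all_fingroup all_algebra cyclic finfield.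
From mathcomp Require Import boolp classical_sets functions cardinality.

Set Implicit Arguments.
Unset Strict Implicit.
Unset Printing Implicit Defensive.

Import GRing.Theory.

(** * Bijections and group isomorphisms *)

Lemma inj_surj_bijective (A B : Type) (f : A -> B) :
  injective f -> (forall y, exists x, f x = y) -> bijective f.
Proof.
move=> f_inj f_surj; have [g fg] := choice f_surj.
by exists g => // x; apply: f_inj; rewrite fg.
Qed.

Section Isomorphic.
Local Open Scope group_scope.

Lemma isomorphic_of_bijective (G H : groupType) (f : G -> H) :
  {morph f : x y / x * y} -> bijective f -> isomorphic G H.
Proof.
move=> fM f_bij.
pose f' : {multiplicative G -> H} :=
  HB.pack f (isMultiplicative.Build G H f fM).
by exists f'.
Qed.

Lemma isomorphic_sym (G H : groupType) : isomorphic G H -> isomorphic H G.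
Proof.
case=> f [g fK gK]; apply: (@isomorphic_of_bijective _ _ g); last by exists f.
by move=> x y; apply: (can_inj fK); rewrite gmulfM !gK.
Qed.

Lemma isomorphic_trans (G H K : groupType) :
  isomorphic G H -> isomorphic H K -> isomorphic G K.
Proof. by case=> f f_bij [g g_bij]; exists (g \o f); apply: bij_comp. Qed.

End Isomorphic.

(** * Unit groups under ring morphisms *)

Section UnitGroupTheory.
Local Open Scope ring_scope.

(** Surjectivity is asked for units only, so that the inclusion of a subring qualifies when the
    subring contains each unit together with its inverse. *)
Lemma unitGroup_isomorphic (R S : comPzRingType) (f : {rmorphism R -> S}) :
  injective f ->
  (forall y, y \in @invertible S -> exists2 x, x \in @invertible R & f x = y) ->
  isomorphic (unitGroup R) (unitGroup S).
Proof.
move=> f_inj f_surj.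
have fU (x : unitGroup R) : f (val x) \in @invertible S.
  case: x => x /= /asboolP[y xy1]; apply/asboolP.
  by exists (f y); rewrite -rmorphM xy1 rmorph1.
apply: (@isomorphic_of_bijective _ _ (fun x => UnitGroup (fU x))).
  by move=> x y; apply: val_inj; rewrite /= rmorphM.
apply: inj_surj_bijective => [x y /(congr1 val)/f_inj/val_inj //|[y Uy]].
have [x Ux fx] := f_surj y Uy.
by exists (UnitGroup Ux); apply: val_inj.
Qed.

Lemma unitGroup_isomorphic_bij (R S : comPzRingType) (f : {rmorphism R -> S}) :
  bijective f -> isomorphic (unitGroup R) (unitGroup S).
Proof.
case=> g fK gK; apply: (unitGroup_isomorphic (can_inj fK)) => y /asboolP[z yz1].
exists (g y) => //; apply/asboolP; exists (g z).
by apply: (can_inj fK); rewrite rmorphM !gK yz1 rmorph1.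
Qed.

End UnitGroupTheory.

(** * Finite reduced rings as products of fields *)

Section FiniteReducedRing.
Local Open Scope ring_scope.
Variable S : finComPzRingType.

Definition reduced := forall x : S, x * x = 0 -> x = 0.

(* Minimality refers to the order on idempotents given by f <= e iff f * e = f. *)
Definition atom : {pred S} := fun e => [&& e != 0, e * e == e &
  [forall f : S, (f * f == f) && (f * e == f) ==> (f == 0) || (f == e)]].

(** If x^(n+2) = 0 then x^(n+1) squares to 0, which lowers the exponent by one. *)
Lemma reduced_expr_eq0 (x : S) n : reduced -> x ^+ n = 0 -> x = 0.
Proof.
move=> red_S; elim: n => [|[_|n IHn xn0]].
- by rewrite expr0 => x0; rewrite -[x]mulr1 x0 mulr0.
- by rewrite expr1.
by apply/IHn/red_S; rewrite -exprD addSnnS exprD xn0 mulr0.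
Qed.

(* Pigeonhole gives x^i = x^(i+d) with d > 0, so that x (1 - x^d) is nilpotent. *)
Lemma reduced_expr_period (x : S) :
  reduced -> exists2 d, (0 < d)%N & x ^+ d * x = x.
Proof.
move=> red_S.
have /injectivePn[i [j neq_ij eq_ij]] :
    ~~ injectiveb (fun i : 'I_(#|S|.+1) => x ^+ i).
  apply: contraTN isT => /injectiveP/leq_card.
  by rewrite card_ord ltnn.
wlog lt_ij : i j neq_ij eq_ij / (i < j)%N.
  move=> IH; case: (ltngtP i j) => [|lt_ji|/val_inj eij]; first exact: IH.
    by apply: (IH j i) => //; rewrite eq_sym.
  by rewrite eij eqxx in neq_ij.
exists (j - i)%N; first by rewrite subn_gt0.
have /eqP: x * (1 - x ^+ (j - i)%N) = 0.
  apply: (@reduced_expr_eq0 _ i.+1 red_S).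
  rewrite exprMn exprSr (exprS (1 - _)) mulrACA mulrBr mulr1 -exprD.
  by rewrite subnKC ?(ltnW lt_ij) // eq_ij subrr mul0r.
by rewrite mulrBr mulr1 subr_eq0 mulrC => /eqP.
Qed.

Lemma atom_neq0 (e : S) : e \in atom -> e != 0.
Proof. by case/and3P. Qed.

Lemma atom_idem (e : S) : e \in atom -> e * e = e.
Proof. by case/and3P=> _ /eqP. Qed.

Lemma atom_minimal (e f : S) :
  e \in atom -> f * f = f -> f * e = f -> f != 0 -> f = e.
Proof.
case/and3P=> _ _ /forallP/(_ f) + ff fe f0.
by rewrite ff fe eqxx (negPf f0) => /eqP.
Qed.

(** The product e f is an idempotent below both e and f; if it were nonzero, minimality would make
    it equal to both. *)
Lemma atom_orthogonal (e f : S) :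
  e \in atom -> f \in atom -> e != f -> e * f = 0.
Proof.
move=> ae af; apply: contraNeq => ef0.
have ef_idem : e * f * (e * f) = e * f by rewrite mulrACA !atom_idem.
rewrite -{1}(atom_minimal ae ef_idem _ ef0); last by rewrite mulrAC atom_idem.
by rewrite {1}(atom_minimal af ef_idem _ ef0) // -mulrA atom_idem.
Qed.

(** Strong induction on the number of nonzero idempotents below f: if f is not an atom, some nonzero
    idempotent g lies strictly below it, and passing to g loses at least f from the count. *)
Lemma atom_exists (f : S) :
  f * f = f -> f != 0 -> exists2 e, e \in atom & e * f = e.
Proof.
move=> ff f0; pose below (g h : S) := [&& h != 0, h * h == h & h * g == h].
have [n] := ubnP #|below f|; elim: n f ff f0 => // n IHn f ff f0 lt_n.
have [af|] := boolP (f \in atom); first by exists f.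
rewrite unfold_in f0 ff eqxx /= => /forallPn[g].
rewrite negb_imply negb_or => /andP[/andP[/eqP gg /eqP gf] /andP[g0 neq_gf]].
have [|e ae eg] := IHn g gg g0; last first.
  by exists e; rewrite // -eg -mulrA gf.
rewrite -ltnS (leq_trans _ lt_n) // ltnS; apply: proper_card.
apply/properP; split; first apply/fintype.subsetP => h /and3P[h0 hh /eqP hg].
  by rewrite unfold_in /below h0 hh -hg -mulrA gf eqxx.
exists f; rewrite unfold_in /below f0 ff eqxx //=.
by rewrite mulrC gf.
Qed.

(** By orthogonality the sum s fixes every atom, so 1 - s is an idempotent killed by all atoms. Were
    it nonzero, it would lie above some atom. *)
Lemma sum_atom : \sum_(e in atom) e = 1 :> S.
Proof.
set s := \sum_(e in atom) e.
have es (e : S) : e \in atom -> e * s = e.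
  move=> ae; rewrite mulr_sumr (bigD1 e) //= atom_idem // big1 ?addr0 // => f.
  by case/andP=> af fe; rewrite atom_orthogonal // eq_sym.
have ss : s * s = s by rewrite {1}/s mulr_suml; apply: eq_bigr => e /es.
have [/eqP|s1] := eqVneq (1 - s) 0; first by rewrite subr_eq0 => /eqP.
have [|e ae] := @atom_exists (1 - s) _ s1.
  by rewrite mulrBr mulr1 mulrBl mul1r ss subrr subr0.
rewrite mulrBr mulr1 es // subrr => /esym/eqP.
by rewrite (negPf (atom_neq0 ae)).
Qed.

Section Corner.
Variables (e : S) (ae : e \in atom) (red_S : reduced).

(** As e is idempotent, this is the ideal e S, in decidable form. *)
Definition corner_pred : {pred S} := fun x => x * e == x.

Fact corner_zmod_closed : zmod_closed corner_pred.
Proof.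
split=> [|x y /eqP xe /eqP ye]; first by rewrite unfold_in mul0r.
by rewrite unfold_in mulrBl xe ye.
Qed.
HB.instance Definition _ :=
  GRing.isZmodClosed.Build S corner_pred corner_zmod_closed.

(* The proofs [ae] and [red_S] index the type so that the field instance, which
   depends on them, can be inferred from it. *)
Record corner := Corner {
  corner_val :> S;
  corner_valP : let _ := (ae, red_S) in corner_val \in corner_pred }.

HB.instance Definition _ := [isSub for corner_val].
HB.instance Definition _ := [Finite of corner by <:].
HB.instance Definition _ := [SubChoice_isSubZmodule of corner by <:].

Implicit Types x y z : corner.

Fact corner_one_subproof : e \in corner_pred.
Proof. by rewrite unfold_in atom_idem. Qed.

Fact corner_mul_subproof (a b : S) : b \in corner_pred -> a * b \in corner_pred.
Proof. by move=> /eqP be; rewrite unfold_in -mulrA be. Qed.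

Definition corner_one := Corner corner_one_subproof.
Definition corner_mul x y := Corner (corner_mul_subproof (val x) (valP y)).

Lemma corner_val_mul x : val x * e = val x. Proof. exact/eqP/(valP x). Qed.

Fact corner_mulA : associative corner_mul.
Proof. by move=> x y z; apply: val_inj; rewrite /= mulrA. Qed.

Fact corner_mulC : commutative corner_mul.
Proof. by move=> x y; apply: val_inj; rewrite /= mulrC. Qed.

Fact corner_mul1 : left_id corner_one corner_mul.
Proof. by move=> x; apply: val_inj; rewrite /= mulrC corner_val_mul. Qed.

Fact corner_mulDl : left_distributive corner_mul +%R.
Proof. by move=> x y z; apply: val_inj; rewrite /= mulrDl. Qed.

Fact corner_one_neq0 : corner_one != 0.
Proof. by rewrite -val_eqE /= atom_neq0. Qed.

HB.instance Definition _ := GRing.Zmodule_isComNzRing.Build corner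
  corner_mulA corner_mulC corner_mul1 corner_mulDl corner_one_neq0.

(** For x nonzero, some power x^d with d > 0 is a nonzero idempotent below e, hence equals e, and
    x^(d-1) inverts x. The case x = 0 fixes the convention that 0 is its own inverse. *)
Lemma corner_exV x : exists y : corner, if x == 0 then y == 0 else y * x == 1.
Proof.
have [_|x0] := eqVneq x 0; first by exists 0.
have [d d_gt0 xdx] := reduced_expr_period (val x) red_S.
(* The factor e matters when d = 1: then x^(d-1) is the unit of S, which may lie outside the
   corner. *)
have ye : val x ^+ d.-1 * e \in corner_pred.
  exact/corner_mul_subproof/corner_one_subproof.
exists (Corner ye); apply/eqP/val_inj => /=.
have -> : val x ^+ d.-1 * e * val x = val x ^+ d.
  by rewrite -mulrA (mulrC e) corner_val_mul -exprSr prednK.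
apply: atom_minimal => //.
- by rewrite -{2}(prednK d_gt0) exprSr mulrA mulrAC xdx -exprS prednK.
- by rewrite -{1}(prednK d_gt0) exprSr -mulrA corner_val_mul -exprSr prednK.
apply: contraNneq x0 => xd0; rewrite -val_eqE /=.
by rewrite -xdx xd0 mul0r.
Qed.

Definition corner_inv x : corner := xchoose (corner_exV x).

Fact corner_mulVf x : x != 0 -> corner_inv x * x = 1.
Proof.
rewrite /corner_inv; move: (xchoose _) (xchooseP (corner_exV x)) => y.
by case: eqP => // _ /eqP.
Qed.

Fact corner_inv0 : corner_inv 0 = 0.
Proof.
rewrite /corner_inv; move: (xchoose _) (xchooseP (corner_exV 0)) => y.
by rewrite eqxx => /eqP.
Qed.

HB.instance Definition _ :=
  GRing.ComNzRing_isField.Build corner corner_mulVf corner_inv0.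

End Corner.

Lemma finite_reduced_ring_isomorphic : reduced ->
  exists (t : nat) (F : 'I_t -> finFieldType)
    (f : {rmorphism S -> directProduct F}), bijective f.
Proof.
move=> red_S; pose a (i : 'I_#|atom|) : S := enum_val i.
have a_atom i : a i \in atom by apply: enum_valP.
pose F i : finFieldType := corner (a_atom i) red_S.
exists #|atom|, F.
have fP i (x : S) : x * a i \in corner_pred (a i).
  exact/corner_mul_subproof/corner_one_subproof.
pose f (x : S) : directProduct F :=
  [ffun i => @Corner _ (a_atom i) red_S _ (fP i x) : F i].
have fB : zmod_morphism f.
  move=> x y; apply/ffunP=> i; rewrite !ffunE.
  by apply: val_inj; rewrite /= mulrBl.
have fM : monoid_morphism f.
  split=> [|x y]; apply/ffunP=> i; rewrite !ffunE; apply: val_inj => /=.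
    by rewrite mul1r.
  by rewrite mulrACA atom_idem.
pose f' : {rmorphism S -> directProduct F} :=
  HB.pack f (GRing.isZmodMorphism.Build _ _ f fB)
    (GRing.isMonoidMorphism.Build _ _ f fM).
(* The inverse adds up the components. One composite multiplies by the sum of the atoms, which is 1;
   the other is the identity by orthogonality. *)
exists f'; exists (fun y : directProduct F => \sum_i (y i : S)) => [x|y].
  under eq_bigr => i _ do rewrite ffunE /=.
  by rewrite -mulr_sumr -(big_enum_val (fun e : S => e)) sum_atom mulr1.
apply/ffunP=> i; rewrite ffunE; apply: val_inj => /=.
rewrite mulr_suml (bigD1 i) //= big1 ?addr0 => [|j neq_ji].
  exact: (corner_val_mul (y i)).
rewrite -(corner_val_mul (y j)) -mulrA (@atom_orthogonal (a j)) ?mulr0 //.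
exact: contra_neq (@enum_val_inj _ _ j i) neq_ji.
Qed.

End FiniteReducedRing.

(** * The subring spanned by the units *)

Section UnitSpan.
Local Open Scope ring_scope.
Variable R : comPzRingType.

(** Plain sums already form the additive group generated by the units, since the negative of a unit
    is a unit. *)
Definition unit_span : {pred R} :=
  fun x => `[< exists s : seq (unitGroup R), x = \sum_(u <- s) val u >].

Lemma unit_span_val (u : unitGroup R) : val u \in unit_span.
Proof. by apply/asboolP; exists [:: u]; rewrite big_seq1. Qed.

Fact unit_span_subring_closed : subring_closed unit_span.
Proof.
have oppU (u : unitGroup R) : - val u \in @invertible R.
  by apply/asboolP; exists (- unitGroup_invr u); rewrite mulrNN unitGroup_mulrV.
split=> [|x y /asboolP[s ->] /asboolP[t ->]|x y /asboolP[s ->] /asboolP[t ->]].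
- exact: unit_span_val (unitGroup_one R).
- apply/asboolP; exists (s ++ [seq UnitGroup (oppU u) | u <- t]).
  by rewrite big_cat big_map /= sumrN.
apply/asboolP; exists [seq unitGroup_mul u v | u <- s, v <- t].
by rewrite big_allpairs_dep mulr_suml; apply: eq_bigr => u _; rewrite mulr_sumr.
Qed.

Record unitSpan := UnitSpan {
  unitSpan_val :> R;
  _ : unitSpan_val \in unit_span }.

HB.instance Definition _ := [isSub for unitSpan_val].
HB.instance Definition _ := [Choice of unitSpan by <:].
HB.instance Definition _ :=
  GRing.SubChoice_isSubComPzRing.Build R unit_span unitSpan
    unit_span_subring_closed.

Lemma unitSpan_isomorphic : isomorphic (unitGroup unitSpan) (unitGroup R).
Proof.
apply: (@unitGroup_isomorphic unitSpan R val); first exact: val_inj.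
move=> y Uy; pose u := UnitGroup Uy.
exists (UnitSpan (unit_span_val u)) => //; apply/asboolP.
exists (UnitSpan (unit_span_val (unitGroup_inv u))).
exact/val_inj/(unitGroup_mulrV u).
Qed.

End UnitSpan.

(** * Rings with a unit group of odd order *)

Section OddUnitGroup.
Local Open Scope ring_scope.
Variables (G : finGroupType) (R : comPzRingType).

Lemma odd_unitGroup_isomorphic :
  isomorphic G (unitGroup R) -> odd #|G| ->
  exists (t : nat) (F : 'I_t -> finFieldType),
    (forall i, 2%N \in [pchar F i]) /\
    isomorphic G (unitGroup (directProduct F)).
Proof.
move=> isoG oddG; have [f [f' fK f'K]] := isoG.
have f1 : f 1%g = 1%g by apply: (mulgI (f 1%g)); rewrite -gmulfM !mulg1.
(* Such a u is a unit, and the order of the matching element of G divides both 2 and the odd number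
   [#|G|]. *)
have sqr1 (u : R) : u * u = 1 -> u = 1.
  move=> uu; have Uu : u \in @invertible R by apply/asboolP; exists u.
  pose g := f' (UnitGroup Uu).
  have gg : (g ^+ 2)%g = 1%g.
    by apply: (can_inj fK); rewrite expgS expg1 gmulfM f'K f1; apply: val_inj.
  have : #[g]%g = 1%N.
    apply/eqP; rewrite -dvdn1 -(eqP (_ : coprime 2 #|G|)) ?coprime2n //.
    by rewrite dvdn_gcd order_dvdn gg eqxx -cardsT order_dvdG ?inE.
  move/eqP; rewrite order_eq1 => /eqP/(congr1 f).
  by rewrite f'K f1 => /(congr1 val).
have addxx (x : R) : x + x = 0.
  have /(congr1 (fun y => x * (1 - y))) : -1 = 1 :> R.
    by apply: sqr1; rewrite mulrNN mulr1.
  by rewrite opprK subrr mulr0 mulrDr mulr1.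
have red_R (x : R) : x * x = 0 -> x = 0.
  move=> xx; apply: (addrI 1); rewrite addr0; apply: sqr1.
  by rewrite mulrDl mul1r mulrDr mulr1 xx addr0 -addrA addxx addr0.
pose h (A : {set G}) : R := \sum_(g in A) val (f g).
(* Since x + x = 0, repeated units cancel in pairs: adding a unit to a sum over A toggles its
   membership in A. *)
have hP (x : unitSpan R) : exists A, val x == h A.
  case: x => _ /= /asboolP[s ->]; elim: s => [|u s [A /eqP sA]].
    by exists finset.set0; rewrite /h big_nil big_set0.
  rewrite big_cons sA -[u]f'K; set g := f' u.
  have [Ag|nAg] := boolP (g \in A).
    exists (A :\ g)%SET; apply/eqP.
    by rewrite {1}/h (big_setD1 g) //= addrA addxx add0r.
  by exists (g |: A)%SET; rewrite /h big_setU1.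
(* Choosing one subset of G for each element of the span injects the span into a finite type. The
   resulting finite structure is put on the span itself, which keeps its ring structure. *)
pose k x := xchoose (hP x).
have kK : pcancel k (fun A => insub (h A)).
  by move=> x; rewrite -(eqP (xchooseP (hP x))) valK.
pose cS := PCanIsCountable kK.
pose C : countType := HB.pack (unitSpan R) cS.
pose fS := @PCanIsFinite C _ k _ kK.
pose S : finComPzRingType := HB.pack (unitSpan R) cS fS.
have red_S : reduced S.
  by move=> x /(congr1 val) /= /red_R x0; apply: val_inj.
have [t [F [g g_bij]]] := finite_reduced_ring_isomorphic red_S.
exists t, F; split=> [i|].
  rewrite inE /=; apply/eqP.
  (* The identity 1 + 1 = 0 of the span is carried over by g and read off at coordinate i. *)
  have /(congr1 (fun y : directProduct F => y i)) : g (1 + 1) = 0.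
    by rewrite (_ : 1 + 1 = 0) ?rmorph0 //; apply/val_inj/addxx.
  by rewrite rmorphD rmorph1 !ffunE.
apply: (isomorphic_trans isoG).
apply: isomorphic_trans (unitGroup_isomorphic_bij g_bij).
exact/isomorphic_sym/unitSpan_isomorphic.
Qed.

End OddUnitGroup.

(** * Counting units *)

Section CardUnitGroup.

(** Equipotence of sets is a bijection between the subtypes they define; conjugating with [to_setT]
    and [val] moves it to the types. *)
Lemma card_eqTT_bijective (A B : Type) :
  ([set: A]%classic #= [set: B]%classic)%card <-> exists f : A -> B, bijective f.
Proof.
have toK (T : Type) : cancel (@to_setT T) val by [].
have ofK (T : Type) : cancel val (@to_setT T) by move=> x; apply: val_inj.
split=> [/card_bijP[f [g fK gK]]|[f [g fK gK]]].
  exists (val \o f \o to_setT); exists (val \o g \o to_setT) => x /=.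
    by rewrite ofK fK.
  by rewrite ofK gK.
apply/card_bijP; exists (to_setT \o f \o val).
exists (to_setT \o g \o val) => x; apply: val_inj => /=; first by rewrite fK.
by rewrite gK.
Qed.

Lemma card_finTypeT (T : finType) : ([set: T]%classic #= `I_#|T|)%card.
Proof.
rewrite card_eq_sym (card_eql card_II); apply/card_eqTT_bijective.
by exists enum_val; apply: enum_val_bij.
Qed.

(** The units are the tuples with all coordinates nonzero; stating this as membership in a [family]
    turns the count into a product. *)
Lemma card_unitGroup_directProduct (t : nat) (F : 'I_t -> finFieldType) :
  ([set: unitGroup (directProduct F)]%classic #=
     `I_(\prod_(i < t) (#|F i| - 1)))%card.
Proof.
pose nz (x : {dffun forall i, F i}) :=
  x \in family (fun i => [pred a : F i | a != 0%R]).
have nzP (x : directProduct F) : reflect (forall i, x i != 0%R) (nz x).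
  by apply: (iffP familyP) => x0 i; have := x0 i; rewrite inE.
have unit_nz (x : unitGroup (directProduct F)) : nz (val x).
  apply/nzP => i; have := unitGroup_mulrV x.
  move/(congr1 (fun y : directProduct F => y i)); rewrite !ffunE; apply: contra_eqN => /eqP->.
  by rewrite mul0r eq_sym oner_eq0.
have nz_unit (x : directProduct F) :
    nz x -> x \in @invertible (directProduct F).
  move/nzP=> x0; apply/asboolP; exists [ffun i => (x i)^-1 : F i]%R.
  by apply/ffunP=> i; rewrite !ffunE; exact: mulfV (x0 i).
have -> : \prod_(i < t) (#|F i| - 1) =
    #|{: {x : {dffun forall i, F i} | nz x}}|.
  rewrite card_sig card_family foldrE big_image /=.
  by apply: eq_bigr => i _; rewrite cardC1 subn1.
apply: card_eq_trans (card_finTypeT _); apply/card_eqTT_bijective.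
exists (fun x => Sub (val x) (unit_nz x)).
exists (fun x => UnitGroup (nz_unit (val x) (valP x))) => x; exact: val_inj.
Qed.

Lemma card_finField_pchar2 (F : finFieldType) :
  2 \in [pchar F]%R -> exists2 n, 0 < n & #|F| = 2 ^ n.
Proof.
move=> F2; have cardF : #|F| = 2 ^ logn 2 #|F| := card_pprimeChar F2.
exists (logn 2 #|F|) => //.
(* Exponent 0 would leave a field with a single element. *)
by have := finNzRing_gt1 F; rewrite {1}cardF; case: (logn _ _).
Qed.

End CardUnitGroup.

Theorem proposition3 :
  (forall G : finGroupType, abelian [set: G]%SET -> odd #|G| ->
     ((exists R : comPzRingType, isomorphic G (unitGroup R)) <->
      (exists (t : nat) (F : 'I_t -> finFieldType),
         (forall i : 'I_t, 2 \in [pchar F i]%R) /\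
         isomorphic G (unitGroup (directProduct F)))))
  /\
  (forall k : nat, odd k ->
     ((exists R : comPzRingType, ([set: unitGroup R]%classic #= `I_k)%card) <->
      (exists (t : nat) (n : 'I_t -> nat),
         (forall i : 'I_t, 0 < n i) /\ k = \prod_(i < t) (2 ^ n i - 1)))).
Proof.
split=> [G _ oddG|k oddk].
  split=> [[R isoG]|[t [F [_ isoG]]]].
    exact: odd_unitGroup_isomorphic isoG oddG.
  by exists (directProduct F).
split=> [[R cardR]|[t [n [n_gt0 ->]]]].
  have /card_eqTT_bijective[f [g fK gK]] :
      ([set: unitGroup R]%classic #= [set: 'I_k]%classic)%card.
    exact: card_eq_trans cardR card_II.
  (* The bijection with ['I_k] makes the unit group itself a finite group G, to which the result on
     odd order applies with the identity as isomorphism. *)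
  pose cR := CanIsCountable fK.
  pose C : countType := HB.pack (unitGroup R) cR.
  pose fR := @CanIsFinite C _ f g fK.
  pose G : finGroupType := HB.pack (unitGroup R) cR fR.
  have cardG : #|G| = k.
    by rewrite -(card_ord k); apply: (@bij_eq_card G 'I_k f); exists g.
  have isoG : isomorphic G (unitGroup R).
    by apply: (@isomorphic_of_bijective _ _ idfun) => //; exists idfun.
  have [|t [F [F2 [h h_bij]]]] := odd_unitGroup_isomorphic isoG.
    by rewrite cardG.
  have /choice[n nP] i : exists n, 0 < n /\ #|F i| = 2 ^ n.
    by have [n] := card_finField_pchar2 (F2 i); exists n.
  exists t, n; split=> [i|]; first by case: (nP i).
  under eq_bigr => i _ do rewrite -(nP i).2.
  apply/card_eq_II; rewrite card_eq_sym in cardR; apply: card_eq_trans cardR _.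
  apply: card_eq_trans (card_unitGroup_directProduct F).
  by apply/card_eqTT_bijective; exists h.
(* Conversely, take a field with 2^(n i) elements for each i. *)
have /choice[F FP] i : exists F : finFieldType, #|F| = 2 ^ n i.
  by have [F _ cardF] := @pPrimePowerField 2 (n i) isT (n_gt0 i); exists F.
exists (directProduct F); under eq_bigr => i _ do rewrite -FP.
exact: card_unitGroup_directProduct.
Qed.
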